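(* Let $\Omega$ be a finite set with $|\Omega|=n$, let $G\le\mathrm{Sym}(\Omega)$ be a permutation group with $G\ne\{e\}$, and let $\mu=\mu^{G\setminus\{e\}}$ be the minimal degree of $G$. For an integer $m$ put $\xi_1=\frac{\sqrt{m^2+(n-m)^2}}{n}$ and $\xi_2=\left(\frac{n}{n+2m}\right)^{1/2}$. (i) Suppose $B\subset G$ is a subset such that $\mu^*:=\mu^{G\setminus B}>\mu$. Then for $0<m<n$ $$\langle \mathrm{Stab}\rangle_m-1<3\sqrt{\frac{m(n-m)}{n}}\left(|G|\,\xi_1^{\mu^*}+|B|\,\xi_1^{\mu}\right),$$ and for $m>0$ $$\langle \mathrm{Stab}\rangle_{(m)}-1<3\sqrt{\frac{m(n+m)}{n}}\left(|G|\,\xi_2^{\mu^*}+|B|\,\xi_2^{\mu}\right).$$ (ii) More generally, let $B_1\subset B_2\subset\dots\subset B_p=G$ be a chain of nested subsets and let $\mu_i=\mu^{G\setminus B_i}$ for $i<p$. Then for $0<m<n$ $$\langle \mathrm{Stab}\rangle_m-1<3\sqrt{\frac{m(n-m)}{n}}\left(\sum_{i=1}^{p-1}(|B_{i+1}|-|B_i|)\,\xi_1^{\mu_i}+|B_1|\,\xi_1^{\mu}\right),$$ and for $m>0$ $$\langle \mathrm{Stab}\rangle_{(m)}-1<3\sqrt{\frac{m(n+m)}{n}}\left(\sum_{i=1}^{p-1}(|B_{i+1}|-|B_i|)\,\xi_2^{\mu_i}+|B_1|\,\xi_2^{\mu}\right).$$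
   Context: For a nonempty subset $K\subset\mathrm{Sym}(\Omega)$, its minimal degree is $\mu^K=\min_{\sigma\in K}|\{\omega\in\Omega:\sigma(\omega)\neq\omega\}|$; every occurrence of $\mu^K$ presupposes $K\neq\emptyset$. The minimal degree of a group $G$ is $\mu^{G\setminus\{e\}}$. $\Omega_m$ is the set of $m$-element subsets of $\Omega$, and $\Omega_{(m)}$ is the set of multisets of weight $m$ on $\Omega$, i.e. functions $\varkappa:\Omega\to\mathbb{Z}_{\ge0}$ with $\sum_{\omega}\varkappa(\omega)=m$; $G$ acts naturally on both. For an action of $G$ on a finite nonempty set $S$ the average stabilizer size is $\frac1{|S|}\sum_{s\in S}|\mathrm{Stab}_G(s)|$; it is denoted $\langle\mathrm{Stab}\rangle_m$ for $S=\Omega_m$ and $\langle\mathrm{Stab}\rangle_{(m)}$ for $S=\Omega_{(m)}$. *)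

(* Defs.v *)
From HB Require Import structures.
From mathcomp Require Import all_boot all_order all_fingroup all_algebra.
From mathcomp Require Import reals.

Set Implicit Arguments.
Unset Strict Implicit.
Unset Printing Implicit Defensive.

Import Order.TTheory GRing.Theory Num.Theory.
Local Open Scope ring_scope.

Section Degree.
Variable Omega : finType.
Implicit Types (s : {perm Omega}) (K : {set {perm Omega}}).

Definition degree s : nat := #|[set w | s w != w]|.

(* Since degree s <= #|Omega| for all s, this is the minimum of the degrees
   over K whenever K is nonempty. The junk value #|Omega| at K = set0 has no
   meaning: uses of mindeg K should come with K != set0. *)
Definition mindeg K : nat := \big[minn/#|Omega|]_(s in K) degree s.

End Degree.

Section Multisets.
Variables (Omega : finType) (m : nat).

Definition msubsets : {set {set Omega}} := [set A : {set Omega} | #|A| == m].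

(* A function Omega -> nat of total weight m takes values in {0, .., m}, so
   bounding the codomain by 'I_m.+1 loses no multiset of weight m and puts the
   multisets in a finType. *)
Definition multisets : {set {ffun Omega -> 'I_m.+1}} :=
  [set k : {ffun Omega -> 'I_m.+1} | (\sum_w k w)%N == m].

(* Push-forward of multiplicities, k |-> k \o g^-1; it restricts to the action
   'P^* on sets, viewed as 0/1-valued functions. *)
Definition mset_act (k : {ffun Omega -> 'I_m.+1}) (g : {perm Omega}) :
  {ffun Omega -> 'I_m.+1} := [ffun w => k ((g^-1)%g w)].

Fact mset_act1 : mset_act^~ 1%g =1 id.
Proof. by move=> k; apply/ffunP => w; rewrite ffunE invg1 perm1. Qed.

Fact mset_actM k : act_morph mset_act k.
Proof. by move=> g h; apply/ffunP => w; rewrite !ffunE invMg permM. Qed.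

Canonical mset_action := TotalAction mset_act1 mset_actM.

End Multisets.

Definition avg_stab (R : realType) (aT : finGroupType) (D : {set aT})
    (rT : finType) (to : action D rT) (G : {set aT}) (S : {set rT}) : R :=
  (\sum_(s in S) #|'C_G[s | to]%g|%:R) / #|S|%:R.

Definition avg_stab_sub (R : realType) (Omega : finType)
    (G : {set {perm Omega}}) (m : nat) : R :=
  avg_stab R ('P^*)%act G (msubsets Omega m).

Definition avg_stab_mset (R : realType) (Omega : finType)
    (G : {set {perm Omega}}) (m : nat) : R :=
  avg_stab R (mset_action Omega m) G (multisets Omega m).

Definition xi1 (R : realType) (n m : nat) : R :=
  Num.sqrt (m%:R ^+ 2 + (n%:R - m%:R) ^+ 2) / n%:R.

Definition xi2 (R : realType) (n m : nat) : R :=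
  Num.sqrt (n%:R / (n%:R + 2 * m%:R)).

(* Main.v *)
Require Import Defs.
From HB Require Import structures.
From mathcomp Require Import all_boot all_order all_fingroup all_algebra.
From mathcomp Require Import reals.
From mathcomp Require Import ring lra.

Set Implicit Arguments.
Unset Strict Implicit.
Unset Printing Implicit Defensive.

Import Order.TTheory GRing.Theory Num.Theory.
Local Open Scope ring_scope.

(* By double counting, [<Stab> - 1] is the sum over [g <> 1] of the proportion
   of points fixed by [g].  The number of fixed sets (multisets) of size [m] is
   the coefficient of [x^m] in the product of [1 + x^c] (of [1 / (1 - x^c)]) over
   the cycle lengths [c] of [g], hence at most [t^-m] times the value at any
   [t > 0].  For [c >= 2] one has [1 + t^c <= (1 + t^2)^(c/2)] and
   [1 - t^c >= (1 - t^2)^(c/2)], so every moved point gains a factor [xi] over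
   a fixed one when [t = m/(n-m)] (resp. [t = m/(n+m)]).  What is left is to
   compare [n^n / (m^m (n-m)^(n-m))] with the binomial coefficient: their ratio
   is at most [sqrt (8 m (n-m) / n)], and [sqrt 8 < 3]. *)

(** * Log-convexity and a lower bound for binomial coefficients *)

Section BinomialLowerBound.
Variable R : realFieldType.
Implicit Types (m k n : nat) (a : nat -> R).

Lemma log_convex_ratio_le a m d :
    (forall n, (0 < n)%N -> 0 < a n) ->
    (forall n, (0 < n)%N -> a n.+1 ^+ 2 <= a n * a n.+2) ->
  (0 < m)%N -> a m.+1 / a m <= a (m + d).+1 / a (m + d)%N.
Proof.
move=> a_gt0 cvx m_gt0; elim: d => [|d IHd]; first by rewrite addn0.
apply: le_trans IHd _; have md_gt0 : (0 < m + d)%N by rewrite addn_gt0 m_gt0.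
rewrite addnS ler_pdivrMr ?a_gt0 // mulrAC ler_pdivlMr ?a_gt0 //.
by rewrite -expr2 mulrC cvx.
Qed.

(** Equality holds at [m = k = 1], which fixes the constant. Raising one index multiplies the left
    side by [a m.+1 / a m] and the right side by the ratio at [m + k], which is at least as
    large. *)
Lemma log_convex_mul_le a m k :
    (forall n, (0 < n)%N -> 0 < a n) ->
    (forall n, (0 < n)%N -> a n.+1 ^+ 2 <= a n * a n.+2) ->
  (0 < m)%N -> (0 < k)%N -> a 2%N * (a m * a k) <= a 1%N ^+ 2 * a (m + k)%N.
Proof.
move=> a_gt0 cvx m_gt0 k_gt0.
pose H i j := a 2%N * (a i * a j) <= a 1%N ^+ 2 * a (i + j)%N.
have HC i j : H i j -> H j i by rewrite /H [a j * _]mulrC addnC.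
have HS i j : (0 < i)%N -> (0 < j)%N -> H i j -> H i.+1 j.
  move=> i_gt0 j_gt0; rewrite /H => Hij.
  have := log_convex_ratio_le j a_gt0 cvx i_gt0.
  rewrite ler_pdivrMr ?a_gt0 // => le_i.
  apply: le_trans (ler_wpM2l (ltW (a_gt0 2%N isT)) (ler_wpM2r _ le_i)) _.
    exact/ltW/a_gt0.
  have aij : 0 < a (i + j)%N by rewrite a_gt0 // addn_gt0 i_gt0.
  rewrite addSn -mulrA mulrCA mulrAC ler_pdivrMr // mulrC.
  rewrite [X in _ <= X]mulrAC; apply: ler_wpM2r => //.
  exact/ltW/a_gt0.
(* The first index is lowered to 1, the roles are swapped by [HC], and the other index is lowered to
   1 in turn. *)
rewrite -/(H m k); case: m k m_gt0 k_gt0 => // m [] // k _ _.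
elim: m => [|m IHm]; last exact: HS.
apply: HC; elim: k => [|k IHk]; last exact: HS.
by rewrite /H mulrC expr2.
Qed.

(* The square of the Stirling ratio [n! e^n / (n^n sqrt n)], without the
   exponential, which cancels in [bin_lower_bound]. *)
Definition stirling2 n : R := n`!%:R ^+ 2 / n%:R ^+ n.*2.+1.

Lemma stirling2_gt0 n : (0 < n)%N -> 0 < stirling2 n.
Proof. by move=> n0; rewrite divr_gt0 ?exprn_gt0 ?ltr0n ?fact_gt0. Qed.

(** Binomial expansion cut after the quadratic term; the inductive step leaves over
    [N * (N - 1) / 2 * y ^+ 3], nonnegative because [N] is a natural number. *)
Lemma binomial_expr_ge (y : R) n :
  0 <= y -> 1 + n%:R * y + n%:R * (n%:R - 1) / 2 * y ^+ 2 <= (1 + y) ^+ n.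
Proof.
move=> y0; elim: n => [|n IHn]; first by rewrite expr0; lra.
have y1 : 0 <= 1 + y by lra.
rewrite [(1 + y) ^+ _]exprS; apply: (le_trans _ (ler_wpM2l y1 IHn)).
have n0 : 0 <= n%:R :> R by [].
have : 0 <= (n%:R * (n%:R - 1) : R).
  by case: n {IHn} n0 => [|n] n0; rewrite ?mul0r // -{2}natr1 addrK mulr_ge0.
move: n0; rewrite -natr1; move: n%:R => N N0 N1.
have : 0 <= N * (N - 1) * y ^+ 3 by rewrite mulr_ge0 // exprn_ge0.
nra.
Qed.

(* The Bernoulli bound on [(x^2 / (x^2 - 1)) ^ n] is needed to second order:
   the square of the first-order bound is below [(x + 1) / (x - 1)]. *)
Lemma stirling2_ratio_le (x : R) n : n%:R = x -> 1 < x ->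
  (x + 1) * (x ^+ 2 - 1) ^+ n.*2 <= (x - 1) * x ^+ (n.*2).*2.
Proof.
move=> nE x1; have p0 : 0 < x ^+ 2 - 1 by nra.
set p := x ^+ 2 - 1 in p0 *.
have pN0 : p != 0 by exact: lt0r_neq0.
have pE : p = (x - 1) * (x + 1) by rewrite /p; ring.
have xB : x - 1 != 0 by apply: lt0r_neq0; lra.
have xD : x + 1 != 0 by apply: lt0r_neq0; lra.
(* [1 + u] is the second-order bound on [(1 + p^-1) ^+ n], with [n] written as [x]. *)
set u : R := x / p + x * (x - 1) / 2 * p^-1 ^+ 2.
have u_ge0 : 0 <= u.
  rewrite addr_ge0 // ?divr_ge0 // ?mulr_ge0 ?exprn_ge0 ?invr_ge0 //; lra.
have Hu : 1 + u <= (x ^+ 2 / p) ^+ n.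
  have -> : x ^+ 2 / p = 1 + p^-1 by rewrite -[x ^+ 2](subrK 1) -/p; field.
  rewrite /u -nE addrA; apply: binomial_expr_ge; rewrite invr_ge0; exact: ltW.
have Hu2 : (1 + u) ^+ 2 <= x ^+ (n.*2).*2 / p ^+ n.*2.
  apply: le_trans (lerXn2r 2 _ _ Hu) _; rewrite ?nnegrE ?exprn_ge0 //.
  - lra.
  - by rewrite divr_ge0 ?exprn_ge0 //; lra.
  by rewrite -exprM muln2 expr_div_n -exprM mul2n.
have Hu3 : x + 1 <= (x - 1) * (1 + u) ^+ 2.
  have -> : 1 + u = (2 * (x + 1) ^+ 2 * (x - 1) + x * (2 * x + 3))
                    / (2 * (x + 1) ^+ 2 * (x - 1)).
    by rewrite /u pE; field; rewrite xB.
  rewrite expr_div_n mulrA ler_pdivlMr; last first.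
    by rewrite exprn_gt0 // !mulr_gt0 ?exprn_gt0 //; lra.
  rewrite -subr_ge0 (_ : _ - _ = (x - 1) * (5 * x ^+ 2 + 12 * x + 8)); last ring.
  by rewrite mulr_ge0 //; nra.
rewrite -ler_pdivlMr ?exprn_gt0 // -mulrA; apply: le_trans Hu3 _.
by rewrite ler_wpM2l // subr_ge0 ltW.
Qed.

(** With the factorials cancelled, this is [stirling2_ratio_le] at [x = n + 1], divided by
    [x - 1]. *)
Lemma stirling2_log_convex n : (0 < n)%N ->
  stirling2 n.+1 ^+ 2 <= stirling2 n * stirling2 n.+2.
Proof.
move=> n_gt0.
have := @stirling2_ratio_le n.+1%:R n.+1 erefl; rewrite ltr1n => /(_ n_gt0).
have xE : n%:R = n.+1%:R - 1 :> R by rewrite -[n.+1%:R]natr1 addrK.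
have xE2 : n.+2%:R = n.+1%:R + 1 :> R by rewrite natr1.
have xB0 : 0 < n.+1%:R - 1 :> R by rewrite -xE ltr0n.
rewrite /stirling2 !factS !natrM xE xE2.
have f0 : 0 < n`!%:R :> R by rewrite ltr0n fact_gt0.
move: n`!%:R f0 n.+1%:R xB0 => f f0 x xB0.
have x0 : 0 < x by lra.
have xD0 : 0 < x + 1 by lra.
rewrite (_ : x ^+ 2 - 1 = (x - 1) * (x + 1)); last ring.
(* Every power is reduced to the exponent [n.*2]; with the three remaining powers taken as atoms,
   the claim becomes a rational inequality. *)
have e1 (y : R) : y ^+ n.*2.+1 = y * y ^+ n.*2 by rewrite exprS.
have e2 (y : R) : y ^+ n.+1.*2 = y ^+ 2 * y ^+ n.*2 by rewrite -exprD.
have e3 (y : R) : y ^+ n.+1.*2.+1 = y ^+ 3 * y ^+ n.*2 by rewrite -exprD.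
have e4 (y : R) : y ^+ n.+1.*2.*2 = y ^+ 4 * y ^+ n.*2 ^+ 2.
  by rewrite -exprM -exprD muln2.
have e5 (y : R) : y ^+ n.+2.*2.+1 = y ^+ 5 * y ^+ n.*2 by rewrite -exprD.
rewrite e1 e2 !e3 e4 e5 !exprMn.
have : 0 < (x - 1) ^+ n.*2 by rewrite exprn_gt0.
have : 0 < (x + 1) ^+ n.*2 by rewrite exprn_gt0.
have : 0 < x ^+ n.*2 by rewrite exprn_gt0.
move: ((x - 1) ^+ n.*2) ((x + 1) ^+ n.*2) (x ^+ n.*2) => a b r r0 b0 a0.
rewrite [X in X <= _ -> _](_ : _ = (x - 1) * (a * b * (x - 1) * (x + 1) ^+ 3)); last ring.
rewrite ler_pM2l // => le_x.
have xBn : x - 1 != 0 by exact: lt0r_neq0.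
have xDn : x + 1 != 0 by exact: lt0r_neq0.
have xn : x != 0 by exact: lt0r_neq0.
have an : a != 0 by exact: lt0r_neq0.
have bn : b != 0 by exact: lt0r_neq0.
have rn : r != 0 by exact: lt0r_neq0.
rewrite [X in X <= _](_ : _ = f ^+ 4 / (x ^+ 2 * r ^+ 2)); last by field; apply/andP.
rewrite [X in _ <= X](_ : _ = f ^+ 4 * x ^+ 2 / (a * b * (x - 1) * (x + 1) ^+ 3)); last first.
  by field; do !(apply/andP; split).
rewrite ler_pdivrMr ?mulr_gt0 ?exprn_gt0 // mulrAC ler_pdivlMr ?mulr_gt0 ?exprn_gt0 //.
apply: le_trans (ler_wpM2l (ltW (exprn_gt0 4 f0)) le_x) _.
by rewrite [X in X <= _](_ : _ = f ^+ 4 * x ^+ 2 * (x ^+ 2 * r ^+ 2)); last ring.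
Qed.

(** This is [log_convex_mul_le] for [stirling2]; the 8 comes from [stirling2 1 = 1] and
    [stirling2 2 = 1/8]. *)
Lemma bin_lower_bound m k : (0 < m)%N -> (0 < k)%N ->
  ((m + k)%:R ^+ (m + k) / (m%:R ^+ m * k%:R ^+ k)) ^+ 2
   <= 8 * (m%:R * k%:R / (m + k)%:R) * 'C(m + k, m)%:R ^+ 2 :> R.
Proof.
move=> m0 k0.
have := log_convex_mul_le stirling2_gt0 stirling2_log_convex m0 k0.
have mR : 0 < m%:R :> R by rewrite ltr0n.
have kR : 0 < k%:R :> R by rewrite ltr0n.
have nR : 0 < (m + k)%:R :> R by rewrite natrD addr_gt0.
rewrite /stirling2.
have <- : 'C(m + k, m)%:R * (m`!%:R * k`!%:R) = (m + k)`!%:R :> R.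
  by rewrite -!natrM -{2}[k](addKn m) bin_fact ?leq_addr.
have F0 : 0 < m`!%:R * k`!%:R :> R by rewrite mulr_gt0 ?ltr0n ?fact_gt0.
have e1 i : i%:R ^+ i.*2.+1 = i%:R * (i%:R ^+ i) ^+ 2 :> R.
  by rewrite exprS -muln2 exprM.
rewrite !{}e1.
have : 0 < m%:R ^+ m :> R by rewrite exprn_gt0.
have : 0 < k%:R ^+ k :> R by rewrite exprn_gt0.
have : 0 < (m + k)%:R ^+ (m + k) :> R by rewrite exprn_gt0.
move: (_ ^+ m) (_ ^+ k) (_ ^+ (m + k)) => M K N N0 K0 M0.
rewrite (_ : 2`!%:R = 2) // (_ : 1`!%:R = 1) //.
move: mR kR nR F0; move: m%:R k%:R (m + k)%:R m`!%:R k`!%:R 'C(m + k, m)%:R.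
move=> x y n f g C x0 y0 n0 F0.
(* This positive factor is common to both sides of the log-convexity inequality; cancelling it
   leaves the claim. *)
have P0 : 0 < (f * g) ^+ 2 / (8 * x * y * N ^+ 2).
  by apply: divr_gt0; rewrite ?exprn_gt0 // !pmulr_rgt0 ?exprn_gt0.
rewrite [X in X <= _ -> _](_ : _ = (f * g) ^+ 2 / (8 * x * y * N ^+ 2) * (N / (M * K)) ^+ 2).
  rewrite [X in _ <= X -> _](_ : _ = (f * g) ^+ 2 / (8 * x * y * N ^+ 2) * (8 * (x * y / n) * C ^+ 2)).
    by rewrite ler_pM2l.
  by field; rewrite ?(lt0r_neq0 x0, lt0r_neq0 y0, lt0r_neq0 n0) ?lt0r_neq0.
by field; rewrite ?(lt0r_neq0 x0, lt0r_neq0 y0, lt0r_neq0 n0) ?lt0r_neq0.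
Qed.

End BinomialLowerBound.

(** * Weighted count of the colourings invariant under a permutation *)

Lemma ler_sum_inj (R : numDomainType) (I J : finType) (P : pred I) (Q : pred J)
    (f : I -> J) (h : J -> R) :
    {in P &, injective f} -> (forall i, P i -> Q (f i)) ->
    (forall j, Q j -> 0 <= h j) ->
  \sum_(i | P i) h (f i) <= \sum_(j | Q j) h j.
Proof.
move=> f_inj PQ h0; rewrite -(big_imset h f_inj) /= big_mkcond [leRHS]big_mkcond.
apply: ler_sum => j _; case: imsetP => [[i Pi ->]|_]; first by rewrite PQ.
by case: ifP => // /h0.
Qed.

Section FixedColourings.
Variables (R : realFieldType) (Omega : finType) (g : {perm Omega}) (m : nat).
Implicit Types (k : {ffun Omega -> 'I_m.+1}) (C : {set Omega}) (t a b : R).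

Definition fixedf k := [forall w, k (g w) == k w].

Lemma fixedf_porbit k x y : fixedf k -> porbit g x = porbit g y -> k x = k y.
Proof.
move=> /forallP kg /eqP; rewrite eq_porbit_mem => /porbitP[i ->].
by elim: i => [|i IHi]; rewrite ?perm1 // expgSr permM (eqP (kg _)).
Qed.

Lemma porbit_fixed x y : porbit g x = porbit g y -> g x = x -> x = y.
Proof.
move=> /esym/eqP; rewrite eq_porbit_mem => /porbitP[i ->] gx.
by elim: i => [|i IHi]; rewrite ?perm1 // expgSr permM -IHi gx.
Qed.

Lemma porbit_card_gt1 x : g x != x -> (1 < #|porbit g x|)%N.
Proof.
move=> gx; rewrite (cardD1 (g x)) (cardD1 x) -{1}[g]expg1 mem_porbit !inE.
by rewrite eq_sym gx porbit_id.
Qed.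

(** For an invariant [k] the point picked in a cycle does not matter; [ord0] is only the default at
    the empty set. *)
Definition onporbits k : {ffun {set Omega} -> 'I_m.+1} :=
  [ffun C : {set Omega} => if [pick x in C] is Some x then k x else ord0].

Lemma onporbitsE k x : fixedf k -> onporbits k (porbit g x) = k x.
Proof.
move=> kg; rewrite ffunE; case: pickP => [y|/(_ x)]; last by rewrite porbit_id.
by rewrite -eq_porbit_mem => /eqP; exact: fixedf_porbit.
Qed.

(** An invariant colouring is determined by one value per cycle, so the sum is at most a product
    over cycles. A fixed point contributes at most [a], a cycle of length [c > 1] at most [b ^+ c],
    that is [b] per moved point. Sets (through indicators) and multisets are both covered. *)
Lemma fixedf_weight_le t a b : 0 <= t -> \sum_(j < m.+1) t ^+ j <= a ->
    (forall c, (1 < c)%N -> \sum_(j < m.+1) (t ^+ c) ^+ j <= b ^+ c) ->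
  \sum_(k | fixedf k) t ^+ (\sum_w k w)%N
    <= a ^+ (#|Omega| - degree g) * b ^+ degree g.
Proof.
move=> t0 Ha Hb.
pose F C (j : 'I_m.+1) : R := \prod_(w | porbit g w == C) t ^+ j.
have F0 C j : 0 <= F C j by apply: prodr_ge0 => *; exact: exprn_ge0.
pose h (f : {ffun {set Omega} -> 'I_m.+1}) := \prod_(C in porbits g) F C (f C).
(* The value [ord0] off the cycles places [Phi k] in the index set of the expanded product in
   [big_distr_big]. *)
pose Phi k := [ffun C => if C \in porbits g then onporbits k C else ord0].
have PhiE k x : fixedf k -> Phi k (porbit g x) = k x.
  by move=> kg; rewrite ffunE imset_f // onporbitsE.
have hE k : fixedf k -> t ^+ (\sum_w k w)%N = h (Phi k).
  move=> kg; rewrite expr_sum /h.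
  rewrite (partition_big_imset (porbit g)) /=; apply: eq_bigr => C _.
  by apply: eq_bigr => w /eqP <-; rewrite PhiE.
rewrite (eq_bigr (h \o Phi)) => [|k kg]; last exact: hE.
have Qle := @ler_sum_inj R _ _ fixedf
  (fun f => f \in pffun_on ord0 (mem (porbits g)) predT) Phi h.
apply: le_trans (Qle _ _ _) _ => /=.
- move=> k1 k2 kg1 kg2 E; apply/ffunP => w.
  by rewrite -[LHS](PhiE k1) // E PhiE.
- move=> k kg; apply/pffun_onP; split => //.
  apply/supportP => C; rewrite ffunE => /negbTE ->//.
- by move=> f _; apply: prodr_ge0.
rewrite -(big_distr_big ord0 (mem (porbits g)) predT F) /=.
(* The bound is written as a product over points, so that it can be regrouped by cycles and compared
   factor by factor. *)
pose G w := if g w == w then a else b.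
have GE : \prod_w G w = a ^+ (#|Omega| - degree g) * b ^+ degree g.
  rewrite (bigID (fun w => g w == w)) /=; congr (_ * _).
    rewrite (eq_bigr (fun=> a)) => [|w gw]; last by rewrite /G gw.
    rewrite prodr_const; congr (_ ^+ _).
    rewrite /degree cardsE -(cardC [pred w | g w != w]) addKn.
    by apply: eq_card => w; rewrite !inE negbK.
  rewrite (eq_bigr (fun=> b)) => [|w gw]; last by rewrite /G (negbTE gw).
  by rewrite prodr_const /degree cardsE.
rewrite -GE (partition_big_imset (porbit g)) /=.
apply: ler_prod => C /imsetP[x _ ->{C}].
apply/andP; split; first exact: sumr_ge0.
have cE : #|[pred w | porbit g w == porbit g x]| = #|porbit g x|.
  by apply: eq_card => w; rewrite !inE eq_porbit_mem.
have FE j : F (porbit g x) j = (t ^+ #|porbit g x|) ^+ j.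
  by rewrite /F prodr_const cE -!exprM mulnC.
under eq_bigr do rewrite FE.
have [gx|gx] := eqVneq (g x) x.
  have px : porbit g x = [set x].
    apply/setP => y; rewrite inE -eq_porbit_mem.
    by apply/eqP/eqP => [/esym/porbit_fixed->|->].
  rewrite px cards1 (big_pred1 x) /G ?gx ?eqxx // => w.
  by rewrite -px eq_porbit_mem px inE.
rewrite [leRHS](eq_bigr (fun=> b)) => [|w /eqP pw]; last first.
  rewrite /G; case: eqP => // gw.
  by move: gx; rewrite -(porbit_fixed pw gw) gw eqxx.
by rewrite prodr_const cE Hb // porbit_card_gt1.
Qed.

End FixedColourings.

(** * Sets and multisets fixed by one permutation *)

Section FixedPoints.
Variables (Omega : finType).
Implicit Types (g : {perm Omega}).

Lemma degree_le g : (degree g <= #|Omega|)%N.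
Proof. exact: max_card. Qed.

Lemma sub_fix_le (R : rcfType) g (m : nat) (t : R) : 0 <= t ->
  #|[set A in msubsets Omega m | ('P^*)%act A g == A]|%:R * t ^+ m
    <= (1 + t) ^+ (#|Omega| - degree g) * Num.sqrt (1 + t ^+ 2) ^+ degree g.
Proof.
move=> t0; set b := Num.sqrt _.
have t2 : 0 <= t ^+ 2 by rewrite exprn_ge0.
have b2 : b ^+ 2 = 1 + t ^+ 2 by rewrite sqr_sqrtr //; lra.
have b1 : 1 <= b by rewrite -(ler_pXn2r (_ : 0 < 2)%N) ?nnegrE ?sqrtr_ge0 // b2 expr1n; lra.
have tb : t <= b by rewrite -(ler_pXn2r (_ : 0 < 2)%N) ?nnegrE ?sqrtr_ge0 // b2; lra.
have Ha : \sum_(j < 2) t ^+ j <= 1 + t by rewrite big_ord_recl big_ord1.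
(* Equality at [c = 2]; then [b * (1 + t ^+ c) >= 1 + t * t ^+ c], because [b] is at least both 1
   and [t]. *)
have Hb c : (1 < c)%N -> \sum_(j < 2) (t ^+ c) ^+ j <= b ^+ c.
  rewrite big_ord_recl big_ord1 /= expr0 expr1.
  case: c => [|[|c _]] //; elim: c => [|c IHc]; first by rewrite b2.
  have tc : 0 <= t ^+ c.+2 by rewrite exprn_ge0.
  rewrite [_ ^+ c.+3]exprS [b ^+ c.+3]exprS; nra.
apply: le_trans (fixedf_weight_le g t0 Ha Hb).
pose ind (A : {set Omega}) := [ffun w : Omega => inord (w \in A) : 'I_2].
have indE A w : ind A w = (w \in A) :> nat by rewrite ffunE inordK //; case: (_ \in _).
pose h (k : {ffun Omega -> 'I_2}) : R := t ^+ (\sum_w k w)%N.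
rewrite -sum1_card natr_sum mulr_suml.
rewrite (eq_bigr (h \o ind)) => [|A]; last first.
  rewrite !inE mul1r => /andP[/eqP <- _]; rewrite /= /h; congr (_ ^+ _).
  by rewrite -sum1_card big_mkcond; apply: eq_bigr => w _; rewrite indE; case: (_ \in _).
apply: (@ler_sum_inj _ _ _ _ (fun k => fixedf g k) ind h) => [A1 A2 _ _ E | A | k _].
- apply/setP => w; have := congr1 (fun k : {ffun Omega -> 'I_2} => k w : nat) E.
  by rewrite !indE; do 2!case: (_ \in _).
- rewrite !inE => /andP[_ /eqP Ag]; apply/forallP => w; apply/eqP/val_inj.
  rewrite /= !indE -{1}Ag; congr (nat_of_bool _).
  exact: (mem_imset _ _ (@perm_inj _ g)).
- exact: exprn_ge0.
Qed.

Lemma mset_fix_le (R : rcfType) g (m : nat) (t : R) : 0 <= t -> t < 1 ->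
  #|[set k in multisets Omega m | mset_action Omega m k g == k]|%:R * t ^+ m
    <= (1 - t)^-1 ^+ (#|Omega| - degree g)
       * (Num.sqrt (1 - t ^+ 2))^-1 ^+ degree g.
Proof.
move=> t0 t1; set s := Num.sqrt _.
have geom (x : R) : 0 <= x -> x < 1 -> \sum_(j < m.+1) x ^+ j <= (1 - x)^-1.
  move=> x0 x1; rewrite -[leRHS]mul1r ler_pdivlMr ?subr_gt0 //.
  have := subrX1 x m.+1; have : 0 <= x ^+ m.+1 by rewrite exprn_ge0.
  by nra.
have t2 : t ^+ 2 < 1 by rewrite exprn_ilt1.
have s0 : 0 < s by rewrite sqrtr_gt0 subr_gt0.
have s2 : s ^+ 2 = 1 - t ^+ 2 by rewrite sqr_sqrtr // subr_ge0 ltW.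
have s1 : s <= 1.
  by rewrite -(ler_pXn2r (_ : 0 < 2)%N) ?nnegrE ?(ltW s0) // s2 expr1n lerBlDr lerDl exprn_ge0.
(* The geometric series reduces this to [s ^+ c <= 1 - t ^+ c]: equality at [c = 2], and raising [c]
   lowers the left side and raises the right side. *)
have Hb c : (1 < c)%N -> \sum_(j < m.+1) (t ^+ c) ^+ j <= s^-1 ^+ c.
  move=> c1; have c0 : (0 < c)%N by exact: ltnW.
  apply: le_trans (geom _ _ _) _; rewrite ?exprn_ge0 ?exprn_ilt1 -?lt0n //.
  rewrite exprVn lef_pV2 ?posrE ?exprn_gt0 // ?subr_gt0 ?exprn_ilt1 -?lt0n //.
  case: c c1 {c0} => [|[|c _]] //; elim: c => [|c IHc]; first by rewrite s2.
  have tc : 0 <= t ^+ c.+2 by rewrite exprn_ge0.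
  have sc : 0 <= s ^+ c.+2 by rewrite exprn_ge0 // ltW.
  rewrite [s ^+ c.+3]exprS [t ^+ c.+3]exprS; nra.
apply: le_trans (fixedf_weight_le g t0 (geom _ t0 t1) Hb).
rewrite -sum1_card natr_sum mulr_suml.
rewrite (eq_bigr (fun k : {ffun Omega -> 'I_m.+1} => t ^+ (\sum_w k w)%N)) => [|k]; last first.
  by rewrite !inE mul1r => /andP[/eqP -> _].
apply: (@ler_sum_inj _ _ _ _ (fun k => fixedf g k) id) => //.
- move=> k; rewrite !inE => /andP[_ /eqP kg]; apply/forallP => w.
  by rewrite -{1}kg ffunE permK.
- by move=> k _; exact: exprn_ge0.
Qed.

(** Stars and bars, carried over from tuples to functions by [fgraph]. *)
Lemma card_multisets n m : #|Omega| = n.+1 -> #|multisets Omega m| = 'C(n + m, n).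
Proof.
move=> hn; rewrite -card_ord_partitions.
have -> : #|[set t : n.+1.-tuple 'I_m.+1 | (\sum_(i <- t) i)%N == m]|
        = #|[set t : #|Omega|.-tuple 'I_m.+1 | (\sum_(i <- t) i)%N == m]| by rewrite hn.
rewrite -(@on_card_preimset _ _ (@fgraph _ _)); last first.
  by exists (@Finfun _ _) => k _; [exact: fgraphK | exact: FinfunK].
apply: eq_card => k; rewrite !inE fgraph_codom /= /codom /image_mem big_map.
by rewrite big_enum.
Qed.

End FixedPoints.

(** * Double counting for the average stabilizer size *)

Section AverageStabilizer.
Variables (R : realType) (Omega : finType) (G : {group {perm Omega}}).
Variables (T : finType) (to : {action {perm Omega} &-> T}) (S : {set T}).

(** Pairs of a point and an element fixing it are counted both ways; the identity fixes all of [S]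
    and accounts for the subtracted 1. *)
Lemma avg_stabB1 : S != set0 ->
  avg_stab R to G S - 1
    = \sum_(g in G :\ 1%g) #|[set s in S | to s g == s]|%:R / #|S|%:R.
Proof.
move=> SN0; have S0 : #|S|%:R != 0 :> R by rewrite pnatr_eq0 cards_eq0.
rewrite /avg_stab -mulr_suml -[X in _ - X](divff S0) -mulrBl; congr (_ / _).
rewrite -!natr_sum; apply/eqP; rewrite subr_eq -natrD eqr_nat; apply/eqP.
have -> : (\sum_(s in S) #|'C_G[s | to]%g| = \sum_(g in G) #|[set s in S | to s g == s]|)%N.
  under eq_bigr => s _ do rewrite -sum1_card (eq_bigl _ _ (fun g => in_setI g _ _)) big_mkcondr.
  rewrite exchange_big; apply: eq_bigr => g _; rewrite -big_mkcondr sum1dep_card.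
  by apply: eq_card => s; rewrite !inE sub1set inE.
rewrite (big_setD1 1%g) //= addnC; congr (_ + _)%N.
by apply: eq_card => s; rewrite !inE act1 eqxx andbT.
Qed.

Lemma avg_stabB1_lt (xi K c X : R) :
    G :!=: 1%g -> S != set0 -> 0 < xi -> K < c ->
    (forall g, #|[set s in S | to s g == s]|%:R / #|S|%:R <= K * xi ^+ degree g) ->
    0 <= c -> \sum_(g in G :\ 1%g) xi ^+ degree g <= X ->
  avg_stab R to G S - 1 < c * X.
Proof.
move=> G1 SN0 xi0 Kc Hg c0 HX; rewrite avg_stabB1 //.
(* A nontrivial element makes the sum of the powers of [xi] positive, so [K < c] yields a strict
   inequality. *)
have [g Gg] : exists g, g \in G :\ 1%g.
  by apply/set0Pn; rewrite setD_eq0 subG1.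
apply: lt_le_trans (ler_wpM2l c0 HX); apply: le_lt_trans (ler_sum _ _) _.
  by move=> i _; exact: Hg.
rewrite -mulr_sumr ltr_pM2r // (bigD1 g) //= ltr_wpDr ?exprn_gt0 //.
by apply: sumr_ge0 => i _; rewrite exprn_ge0 // ltW.
Qed.

End AverageStabilizer.

(** * Sums of [xi ^+ degree g] over a group cut into layers *)

Section DegreeSums.
Variables (R : realType) (Omega : finType) (G : {group {perm Omega}}).

Lemma mindeg_le (K : {set {perm Omega}}) g : g \in K -> (mindeg K <= degree g)%N.
Proof. exact: (@bigmin_le_cond _ nat _ _ g (mem K) (@degree Omega)). Qed.

Lemma sum_expr_degree_le (xi : R) (A K : {set {perm Omega}}) :
  0 <= xi -> xi <= 1 -> A \subset K ->
  \sum_(g in A) xi ^+ degree g <= #|A|%:R * xi ^+ mindeg K.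
Proof.
move=> xi0 xi1 AK; rewrite mulr_natl -sumr_const; apply: ler_sum => g Ag.
by rewrite ler_wiXn2l // mindeg_le // (subsetP AK).
Qed.

(** The group is cut into [B 1] and the layers [B i.+1 :\: B i]. Each layer lies in [G :\: B i], so
    its degrees are at least the minimal degree there. *)
Lemma sum_expr_degree_chain_le (xi : R) p (B : nat -> {set {perm Omega}}) :
    0 <= xi -> xi <= 1 -> (0 < p)%N ->
    (forall i, (1 <= i < p)%N -> B i \subset B i.+1) -> B p = G ->
  \sum_(g in G :\ 1%g) xi ^+ degree g
    <= \sum_(1 <= i < p) (#|B i.+1|%:R - #|B i|%:R) * xi ^+ mindeg (G :\: B i)
       + #|B 1%N|%:R * xi ^+ mindeg (G :\ 1%g).
Proof.
move=> xi0 xi1; case: p => // p _ chain BG; rewrite -{1}BG.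
(* Inclusion in [G] is known at the top of the chain and descends, hence the reversed index. *)
have subG i : (i <= p)%N -> B (p.+1 - i)%N \subset G.
  elim: i => [|i IHi] ip; first by rewrite subn0 BG.
  apply: subset_trans (IHi (ltnW ip)); rewrite subSS [(p.+1 - i)%N]subSn 1?ltnW //.
  by apply: chain; rewrite subn_gt0 ip ltnS leq_subr.
have {}subG i : (i <= p)%N -> B i.+1 \subset G.
  by move=> ip; rewrite -(subKn ip) -subSn ?leq_subr // subG ?leq_subr.
suff: forall q, (q <= p)%N -> \sum_(g in B q.+1 :\ 1%g) xi ^+ degree g
    <= \sum_(1 <= i < q.+1) (#|B i.+1|%:R - #|B i|%:R) * xi ^+ mindeg (G :\: B i)
       + #|B 1%N|%:R * xi ^+ mindeg (G :\ 1%g) by apply.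
elim=> [|q IHq] qp.
  rewrite big_geq // add0r; apply: le_trans (sum_expr_degree_le xi0 xi1 _) _.
    exact: setSD (subG 0 _).
  by rewrite ler_wpM2r ?exprn_ge0 // ler_nat subset_leq_card ?subsetDl.
rewrite big_nat_recr //= addrAC; apply: le_trans (lerD (IHq (ltnW qp)) (lexx _)).
have Bq : B q.+1 \subset B q.+2 by apply: chain.
have -> : #|B q.+2|%:R - #|B q.+1|%:R = #|B q.+2 :\: B q.+1|%:R :> R.
  by rewrite cardsD (setIidPr Bq) natrB // subset_leq_card.
have := sum_expr_degree_le xi0 xi1 (setSD (B q.+1) (subG _ qp)).
move/(lerD (lexx (\sum_(g in B q.+1 :\ 1%g) xi ^+ degree g))); apply: le_trans.
rewrite (big_setID (B q.+1)) /=; apply: lerD.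
  by rewrite setIDAC (setIidPr Bq).
(* If the identity first appears in this layer, the right side has one extra nonnegative term. *)
rewrite big_mkcond [leRHS]big_mkcond; apply: ler_sum => g _.
by rewrite !inE; case: (g \in B q.+1); case: (g \in B q.+2); case: eqP => //= _; rewrite exprn_ge0.
Qed.

End DegreeSums.

(** * Elementary estimates for the final constants and the ratios [xi1], [xi2] *)

(** Here [xi] is the factor of a moved point relative to the factor [a] of a fixed one, so [a ^+ n]
    splits off. *)
Lemma fix_ratio_le (R : realFieldType) (F S t a xi : R) n m d :
    0 < S -> 0 < t -> (d <= n)%N ->
    F * t ^+ m <= a ^+ (n - d) * (a * xi) ^+ d ->
  F / S <= a ^+ n / (t ^+ m * S) * xi ^+ d.
Proof.
move=> S0 t0 dn; rewrite exprMn mulrA -exprD subnK // => HF.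
have tm : 0 < t ^+ m by rewrite exprn_gt0.
rewrite ler_pdivrMr // mulrAC [X in _ <= X](_ : _ = a ^+ n * xi ^+ d / t ^+ m).
  by rewrite ler_pdivlMr.
by field; rewrite !lt0r_neq0.
Qed.

Lemma lt_3sqrt (R : rcfType) (K q : R) : 0 < q -> K ^+ 2 <= 8 * q -> K < 3 * Num.sqrt q.
Proof.
move=> q0 Kq; have s0 : 0 < Num.sqrt q by rewrite sqrtr_gt0.
have s2 := sqr_sqrtr (ltW q0); rewrite ltNge; apply/negP => le_K.
have : (3 * Num.sqrt q) ^+ 2 <= K ^+ 2.
  by rewrite lerXn2r ?nnegrE //; nra.
by rewrite exprMn s2; lra.
Qed.

Lemma card_gt0_of_perm_neq1 (Omega : finType) (G : {group {perm Omega}}) :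
  G :!=: 1%g -> (0 < #|Omega|)%N.
Proof.
move=> G1; rewrite lt0n; apply: contra G1 => /eqP n0; rewrite -subG1.
apply/subsetP => g _; rewrite inE; apply/eqP/permP => w.
by have := card0_eq n0 w; rewrite inE.
Qed.

Section Xi.
Variables (R : realType) (n m : nat).

Lemma xi1_gt0 : (0 < m < n)%N -> 0 < xi1 R n m.
Proof.
move=> /andP[m0 mn]; rewrite divr_gt0 ?ltr0n ?(ltn_trans m0) // sqrtr_gt0.
by rewrite ltr_pwDl ?exprn_gt0 ?ltr0n // sqr_ge0.
Qed.

Lemma xi1_le1 : (0 < m < n)%N -> xi1 R n m <= 1.
Proof.
move=> /andP[m0 mn]; have n0 : 0 < n%:R :> R by rewrite ltr0n (ltn_trans m0).
rewrite ler_pdivrMr // mul1r -[leRHS](ger0_norm (ltW n0)) -sqrtr_sqr.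
rewrite ler_wsqrtr //.
have : 0 <= m%:R * (n%:R - m%:R) :> R.
  by rewrite mulr_ge0 // subr_ge0 ler_nat ltnW.
by lra.
Qed.

Lemma xi2_gt0 : (0 < n)%N -> 0 < xi2 R n m.
Proof.
rewrite -(ltr0n R) => n0.
by rewrite sqrtr_gt0 divr_gt0 // ltr_pwDl // mulr_ge0.
Qed.

Lemma xi2_le1 : (0 < n)%N -> xi2 R n m <= 1.
Proof.
rewrite -(ltr0n R) => n0.
rewrite -[leRHS]sqrtr1 ler_sqrt // ler_pdivrMr ?mul1r ?lerDl ?mulr_ge0 //.
by rewrite ltr_pwDl // mulr_ge0.
Qed.

End Xi.

(** * The two averages bounded by sums over the nontrivial elements *)

Section AverageStabilizerBounds.
Variables (R : realType) (Omega : finType) (G : {group {perm Omega}}).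
Let n := #|Omega|.

(* The generating function [\sum_k |Fix_k| x^k] is evaluated at [x = m/(n-m)],
   the saddle point of [(1 + x)^n / x^m]. *)
Lemma avg_stab_subB1_lt m X : G :!=: 1%g -> (0 < m < n)%N ->
  \sum_(g in G :\ 1%g) xi1 R n m ^+ degree g <= X ->
  avg_stab_sub R G m - 1 < 3 * Num.sqrt (m%:R * (n%:R - m%:R) / n%:R) * X.
Proof.
move=> G1 mn; have [m0 m_lt] := andP mn.
have cS : #|msubsets Omega m| = 'C(n, m) by exact: card_draws.
have [k nE] : exists k, n = (m + k)%N by exists (n - m)%N; rewrite subnKC // ltnW.
have k0 : (0 < k)%N by move: m_lt; rewrite nE -ltn_subLR // subnn.
have mR : 0 < m%:R :> R by rewrite ltr0n.
have kR : 0 < k%:R :> R by rewrite ltr0n.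
have nkE : n%:R - m%:R = k%:R :> R by rewrite nE natrD addrAC subrr add0r.
have nRE : n%:R = m%:R + k%:R :> R by rewrite nE natrD.
have cS0 : 0 < #|msubsets Omega m|%:R :> R by rewrite cS ltr0n bin_gt0 ltnW.
pose t : R := m%:R / k%:R.
apply: (@avg_stabB1_lt R _ G _ ('P^*)%act (msubsets Omega m) (xi1 R n m)
  ((1 + t) ^+ n / (t ^+ m * #|msubsets Omega m|%:R))) => //.
- by rewrite -card_gt0 -(ltr0n R).
- exact: xi1_gt0.
- apply: lt_3sqrt; first by rewrite nkE divr_gt0 ?mulr_gt0 // nRE addr_gt0.
  have := @bin_lower_bound R m k m0 k0; rewrite -nE nkE cS => le_bin.
  have C0 : 0 < 'C(n, m)%:R :> R by rewrite -cS.
  have -> : (1 + t) ^+ n / (t ^+ m * 'C(n, m)%:R)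
     = n%:R ^+ n / (m%:R ^+ m * k%:R ^+ k) / 'C(n, m)%:R.
    have -> : 1 + t = n%:R / k%:R by rewrite nRE /t; field; rewrite lt0r_neq0.
    rewrite !expr_div_n {3}nE exprD.
    by field; rewrite !expf_neq0 ?lt0r_neq0.
  by rewrite expr_div_n ler_pdivrMr ?exprn_gt0.
- move=> g; apply: fix_ratio_le => //; rewrite ?divr_gt0 ?degree_le //.
  have t0 : 0 <= t by rewrite divr_ge0.
  (* At the saddle point the gain per moved point is exactly [xi1]. *)
  have -> : (1 + t) * xi1 R n m = Num.sqrt (1 + t ^+ 2); last exact: sub_fix_le.
  rewrite /xi1 nkE.
  have -> : 1 + t ^+ 2 = (m%:R ^+ 2 + k%:R ^+ 2) / k%:R ^+ 2.
    by rewrite /t; field; rewrite lt0r_neq0.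
  rewrite sqrtrM ?addr_ge0 ?exprn_ge0 // sqrtrV ?exprn_ge0 // sqrtr_sqr ger0_norm //.
  rewrite nRE /t; field; rewrite !lt0r_neq0 //; exact: addr_gt0.
- by rewrite mulr_ge0 ?sqrtr_ge0.
Qed.

(* The same with [(1 - x)^-n / x^m], whose saddle point is [x = m/(n+m)]. *)
Lemma avg_stab_msetB1_lt m X : G :!=: 1%g -> (0 < m)%N ->
  \sum_(g in G :\ 1%g) xi2 R n m ^+ degree g <= X ->
  avg_stab_mset R G m - 1 < 3 * Num.sqrt (m%:R * (n%:R + m%:R) / n%:R) * X.
Proof.
move=> G1 m0; have n0 : (0 < n)%N := card_gt0_of_perm_neq1 G1.
have mR : 0 < m%:R :> R by rewrite ltr0n.
have nR : 0 < n%:R :> R by rewrite ltr0n.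
have nmR : 0 < n%:R + m%:R :> R by rewrite addr_gt0.
have nS : n = n.-1.+1 by rewrite prednK.
(* Passing from ['C(n + m - 1, n - 1)] to ['C(n + m, n)] lets [bin_lower_bound] apply to the parts
   [n] and [m]. *)
have cS : (n%:R + m%:R) * #|multisets Omega m|%:R = n%:R * 'C(n + m, n)%:R :> R.
  rewrite (card_multisets m nS) -natrD -!natrM; congr (_%:R).
  have := mul_bin_diag (n + m) n.-1; rewrite prednK // => <-.
  by rewrite {5}nS addSn.
have C0 : 0 < 'C(n + m, n)%:R :> R by rewrite ltr0n bin_gt0 leq_addr.
have cS0 : 0 < #|multisets Omega m|%:R :> R.
  by rewrite -(pmulr_rgt0 _ nmR) cS mulr_gt0.
pose t : R := m%:R / (n%:R + m%:R).
have t0 : 0 < t by rewrite divr_gt0.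
have t1 : t < 1 by rewrite ltr_pdivrMr // mul1r ltrDr.
apply: (@avg_stabB1_lt R _ G _ (mset_action Omega m) (multisets Omega m) (xi2 R n m)
  ((1 - t)^-1 ^+ n / (t ^+ m * #|multisets Omega m|%:R))) => //.
- by rewrite -card_gt0 -(ltr0n R).
- exact: xi2_gt0.
- apply: lt_3sqrt; first by rewrite divr_gt0 ?mulr_gt0.
  have := @bin_lower_bound R n m n0 m0; rewrite natrD => le_bin.
  (* The square of the extra factor [(n + m) / n] turns [8 n m / (n + m)] into [8 m (n + m) / n]. *)
  have -> : (1 - t)^-1 ^+ n / (t ^+ m * #|multisets Omega m|%:R)
     = (n%:R + m%:R) ^+ (n + m) / (n%:R ^+ n * m%:R ^+ m)
       * ((n%:R + m%:R) / (n%:R * 'C(n + m, n)%:R)).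
    have -> : (1 - t)^-1 = (n%:R + m%:R) / n%:R.
      by rewrite /t; field; rewrite !lt0r_neq0.
    rewrite -cS !expr_div_n exprD.
    by field; rewrite !expf_neq0 ?lt0r_neq0.
  rewrite exprMn; apply: le_trans (ler_wpM2r (sqr_ge0 _) le_bin) _.
  rewrite le_eqVlt; apply/orP; left; apply/eqP.
  by field; rewrite !lt0r_neq0.
- move=> g; apply: fix_ratio_le => //; rewrite ?degree_le //.
  (* Equivalently [xi2] is the square root of [(1 - t) / (1 + t)]. *)
  have -> : (1 - t)^-1 * xi2 R n m = (Num.sqrt (1 - t ^+ 2))^-1; last exact: mset_fix_le (ltW t0) t1.
  have t1' : 0 < 1 - t by rewrite subr_gt0.
  have d0 : 0 < n%:R + 2 * m%:R :> R by rewrite addr_gt0 // mulr_gt0.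
  rewrite /xi2 -[(1 - t)^-1]ger0_norm ?invr_ge0 ?(ltW t1') // -sqrtr_sqr.
  rewrite -sqrtrM ?sqr_ge0 // -sqrtrV; last first.
    by rewrite subr_ge0 exprn_ile1 ?ltW.
  congr Num.sqrt; rewrite /t; field.
  rewrite addrK subr_sqr addrK -addrA -[m%:R + m%:R](mulr_natl _ 2).
  by rewrite !lt0r_neq0 ?(mulr_gt0 nR d0).
- by rewrite mulr_ge0 ?sqrtr_ge0.
Qed.

End AverageStabilizerBounds.

(** * Assembly, with part (i) as a chain of two sets *)

Theorem mainTheorem2 (R : realType) (Omega : finType) (n : nat)
    (hn : #|Omega| = n) (G : {group {perm Omega}}) (hG : G :!=: 1%g)
    (mu : nat) (hmu : mu = mindeg (G :\ 1%g)) :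
  (forall B : {set {perm Omega}},
      B \subset G -> G :\: B != set0 -> (mu < mindeg (G :\: B))%N ->
      (forall m : nat, (0 < m < n)%N ->
         avg_stab_sub R G m - 1 <
           3 * Num.sqrt (m%:R * (n%:R - m%:R) / n%:R)
             * (#|G|%:R * xi1 R n m ^+ mindeg (G :\: B)
                + #|B|%:R * xi1 R n m ^+ mu)) /\
      (forall m : nat, (0 < m)%N ->
         avg_stab_mset R G m - 1 <
           3 * Num.sqrt (m%:R * (n%:R + m%:R) / n%:R)
             * (#|G|%:R * xi2 R n m ^+ mindeg (G :\: B)
                + #|B|%:R * xi2 R n m ^+ mu))) /\
  (forall (p : nat) (B : nat -> {set {perm Omega}}),
      (0 < p)%N ->
      (forall i : nat, (1 <= i < p)%N -> B i \subset B i.+1) ->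
      B p = G ->
      (forall i : nat, (1 <= i < p)%N -> G :\: B i != set0) ->
      (forall m : nat, (0 < m < n)%N ->
         avg_stab_sub R G m - 1 <
           3 * Num.sqrt (m%:R * (n%:R - m%:R) / n%:R)
             * (\sum_(1 <= i < p) (#|B i.+1|%:R - #|B i|%:R)
                                    * xi1 R n m ^+ mindeg (G :\: B i)
                + #|B 1%N|%:R * xi1 R n m ^+ mu)) /\
      (forall m : nat, (0 < m)%N ->
         avg_stab_mset R G m - 1 <
           3 * Num.sqrt (m%:R * (n%:R + m%:R) / n%:R)
             * (\sum_(1 <= i < p) (#|B i.+1|%:R - #|B i|%:R)
                                    * xi2 R n m ^+ mindeg (G :\: B i)
                + #|B 1%N|%:R * xi2 R n m ^+ mu))).
Proof.
subst n mu; have n0 := card_gt0_of_perm_neq1 hG.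
have onestep (B : {set {perm Omega}}) (xi : R) :
    B \subset G -> 0 <= xi -> xi <= 1 ->
    \sum_(g in G :\ 1%g) xi ^+ degree g
      <= #|G|%:R * xi ^+ mindeg (G :\: B) + #|B|%:R * xi ^+ mindeg (G :\ 1%g).
  move=> BG xi0 xi1.
  (* Chains are indexed from 1, so the leading [set0] is a filler. The coefficient [#|G| - #|B|] is
     then enlarged to [#|G|]. *)
  have := @sum_expr_degree_chain_le R Omega G xi 2 (nth set0 [:: set0; B; G : {set _}]).
  move=> /(_ xi0 xi1 isT); rewrite big_nat1 /= => H; apply: le_trans (H _ erefl) _.
    by case=> [|[|i]].
  by rewrite lerD2r ler_wpM2r ?exprn_ge0 // lerBlDr lerDl.
split=> [B BG _ _ | p B p0 chain BG _]; split=> m m_range.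
- apply: avg_stab_subB1_lt => //; apply: onestep => //; last exact: xi1_le1.
  exact/ltW/xi1_gt0.
- apply: avg_stab_msetB1_lt => //; apply: onestep => //; last exact: xi2_le1.
  exact/ltW/xi2_gt0.
- apply: avg_stab_subB1_lt => //; apply: sum_expr_degree_chain_le => //.
    exact/ltW/xi1_gt0.
  exact: xi1_le1.
- apply: avg_stab_msetB1_lt => //; apply: sum_expr_degree_chain_le => //.
    exact/ltW/xi2_gt0.
  exact: xi2_le1.
Qed.
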